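(* Let $V=\{1,\dots,n\}$ and let $f:2^V\to\mathbb{R}$ be a polymatroid function with $f(\{j\})>0$ for all $j\in V$ and $\kappa_f<1$. Let $f^{\kappa}$ be its curve-normalized version, let $\alpha\ge 1$, and let $\hat f^{\kappa}$ be a submodular function and $X\subseteq V$ a set with $\hat f^{\kappa}(X)\le f^{\kappa}(X)\le \alpha\,\hat f^{\kappa}(X)$. Define $\hat f(Y)=\kappa_f\hat f^{\kappa}(Y)+(1-\kappa_f)\sum_{j\in Y}f(\{j\})$. Then $$\hat f(X)\le f(X)\le \frac{\alpha}{1+(\alpha-1)(1-\kappa_f)}\hat f(X)\le \frac{\hat f(X)}{1-\kappa_f}.$$ Moreover, the same inequalities hold when $\kappa_f$ is replaced by any upper bound $\bar\kappa$ with $\kappa_f\le\bar\kappa<1$, $\bar\kappa>0$: if $f^{\bar\kappa}(Y)=\frac{f(Y)-(1-\bar\kappa)\sum_{j\in Y}f(\{j\})}{\bar\kappa}$, $\hat g$ is a submodular function with $\hat g(X)\le f^{\bar\kappa}(X)\le\alpha\,\hat g(X)$, and $\hat f'(Y)=\bar\kappa\,\hat g(Y)+(1-\bar\kappa)\sum_{j\in Y}f(\{j\})$, then $\hat f'(X)\le f(X)\le \frac{\alpha}{1+(\alpha-1)(1-\bar\kappa)}\hat f'(X)\le\frac{\hat f'(X)}{1-\bar\kappa}$.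
   Context: A polymatroid function is a monotone nondecreasing, nonnegative, submodular function $f:2^V\to\mathbb{R}$ with $f(\emptyset)=0$. For $S\subseteq V$, $j\notin S$, $f(j\mid S)=f(S\cup\{j\})-f(S)$. The total curvature is $\kappa_f = 1-\min_{j\in V}\frac{f(j\mid V\setminus\{j\})}{f(\{j\})}$. The curve-normalized version is $f^{\kappa}(Y)=\frac{f(Y)-(1-\kappa_f)\sum_{j\in Y}f(\{j\})}{\kappa_f}$ if $\kappa_f>0$ and $f^\kappa\equiv0$ if $\kappa_f=0$. *)

(* Defs.v *)
From mathcomp Require Import all_boot all_order all_algebra.
Set Implicit Arguments.
Unset Strict Implicit.
Unset Printing Implicit Defensive.
Import Order.TTheory GRing.Theory Num.Theory.
Local Open Scope ring_scope.

Definition submodular (R : realFieldType) (V : finType) (f : {set V} -> R) :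
    Prop :=
  forall A B : {set V}, f (A :|: B) + f (A :&: B) <= f A + f B.

Record polymatroid (R : realFieldType) (V : finType) (f : {set V} -> R) :
    Prop := Polymatroid {
  polymatroid0 : f set0 = 0;
  polymatroid_ge0 : forall A : {set V}, 0 <= f A;
  polymatroid_mono : forall A B : {set V}, A \subset B -> f A <= f B;
  polymatroid_submod : submodular f
}.

(* f(j | S), only meant for j \notin S. *)
Definition marginal (R : realFieldType) (V : finType) (f : {set V} -> R)
    (j : V) (S : {set V}) : R :=
  f (j |: S) - f S.

Definition curvature_ratio (R : realFieldType) (V : finType)
    (f : {set V} -> R) (j : V) : R :=
  marginal f j ([set: V] :\ j) / f [set j].

(* The ground set is 'I_n.+1, so that the minimum is over a nonempty set; the
   initial value of the iterated minimum is one of the ratios, hence it adds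
   nothing to the minimum. *)
Definition total_curvature (R : realFieldType) (n : nat)
    (f : {set 'I_n.+1} -> R) : R :=
  1 - \big[Num.min/curvature_ratio f ord0]_(j < n.+1) curvature_ratio f j.

Definition modular_sum (R : realFieldType) (V : finType) (f : {set V} -> R)
    (Y : {set V}) : R :=
  \sum_(j in Y) f [set j].

(* f^k, for k the total curvature of f or an upper bound of it (so k >= 0). *)
Definition curve_normalized (R : realFieldType) (V : finType) (k : R)
    (f : {set V} -> R) (Y : {set V}) : R :=
  if 0 < k then (f Y - (1 - k) * modular_sum f Y) / k else 0.

(* The approximation of f built from an approximation g of f^k. *)
Definition curve_denormalized (R : realFieldType) (V : finType) (k : R)
    (f g : {set V} -> R) (Y : {set V}) : R :=
  k * g Y + (1 - k) * modular_sum f Y.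

(* Main.v *)
(* Write F, m, h, g for f(X), the modular sum, f^k(X) and its approximation, so
   F = k h + (1 - k) m, where F <= m by subadditivity. Then
   alpha (k g + (1 - k) m) >= k h + alpha (1 - k) m
     = F + (alpha - 1) (1 - k) m >= (1 + (alpha - 1) (1 - k)) F,
   which is the middle inequality, and it makes the approximation of F
   nonnegative.  The curvature only matters when k = 0: it then forces F = m. *)
Require Import Defs.
From mathcomp Require Import all_boot all_order all_algebra.
From mathcomp Require Import ring lra.
Set Implicit Arguments.
Unset Strict Implicit.
Unset Printing Implicit Defensive.
Import Order.TTheory GRing.Theory Num.Theory.
Local Open Scope ring_scope.

(** Diminishing returns: this is submodularity for [j |: S] and [T]. As [j] lies outside [T], and
    hence outside [S], these two sets meet exactly in [S]. *)
Lemma submodular_marginal_le (R : realFieldType) (V : finType)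
    (f : {set V} -> R) (j : V) (S T : {set V}) :
  submodular f -> S \subset T -> j \notin T -> marginal f j T <= marginal f j S.
Proof.
move=> f_sub sST jT; have := f_sub (j |: S) T; rewrite /marginal.
have -> : (j |: S) :|: T = j |: T by rewrite -setUA (setUidPr sST).
have -> : (j |: S) :&: T = S.
  apply/setP => x; rewrite !inE.
  have [->|_] /= := eqVneq x j; last exact/andb_idr/subsetP.
  by rewrite (negPf jT); apply/esym/negbTE; apply: contra jT; apply/subsetP.
by lra.
Qed.

(** Telescoping: building [X] from the empty set one element at a time writes [f X] as a sum of
    marginals, each bounded by hypothesis. *)
Lemma sum_marginal_bounds (R : realFieldType) (V : finType)
    (f : {set V} -> R) (a b : V -> R) (X : {set V}) :
  f set0 = 0 ->
  (forall (j : V) (S : {set V}), j \notin S -> a j <= marginal f j S <= b j) ->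
  \sum_(j in X) a j <= f X <= \sum_(j in X) b j.
Proof.
move=> f0 ab; have [m] := ubnP #|X|; elim: m X => // m IHm X leX.
have [->|[j jX]] := set_0Vmem X; first by rewrite !big_set0 f0 lexx.
have /IHm/andP[aX bX] : (#|X :\ j| < m)%N by move: leX; rewrite (cardsD1 j) jX.
have /ab : j \notin X :\ j by rewrite !inE eqxx.
by rewrite /marginal setD1K // !(big_setD1 j jX) /=; lra.
Qed.

Lemma marginal0 (R : realFieldType) (V : finType) (f : {set V} -> R) (j : V) :
  f set0 = 0 -> marginal f j set0 = f [set j].
Proof. by move=> f0; rewrite /marginal setU0 f0 subr0. Qed.

Lemma total_curvature_ratio (R : realFieldType) (n : nat)
    (f : {set 'I_n.+1} -> R) (j : 'I_n.+1) :
  1 - total_curvature f <= curvature_ratio f j.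
Proof. by rewrite /total_curvature subKr; apply: bigmin_le_cond. Qed.

Section Polymatroid.
Variables (R : realFieldType) (n : nat) (f : {set 'I_n.+1} -> R).
Hypotheses (f_poly : polymatroid f) (f_pos : forall j, 0 < f [set j]).

(** Since [S] lies between the empty set and the complement of [j], diminishing returns puts its
    marginal between those of these two extremes; the curvature controls the smaller one. *)
Lemma marginal_curvature_bounds (j : 'I_n.+1) (S : {set 'I_n.+1}) :
  j \notin S ->
  (1 - total_curvature f) * f [set j] <= marginal f j S <= f [set j].
Proof.
move=> jS; apply/andP; split; last first.
  rewrite -(marginal0 j (polymatroid0 f_poly)).
  by apply: submodular_marginal_le; rewrite ?sub0set //; case: f_poly.
have /le_trans -> // : (1 - total_curvature f) * f [set j]
    <= marginal f j ([set: 'I_n.+1] :\ j).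
  by rewrite -ler_pdivlMr // total_curvature_ratio.
apply: submodular_marginal_le; first by case: f_poly.
  by apply/subsetD1P; rewrite subsetT.
by rewrite !inE eqxx.
Qed.

Lemma total_curvature_ge0 : 0 <= total_curvature f.
Proof.
have jV : ord0 \notin [set: 'I_n.+1] :\ ord0 by rewrite !inE eqxx.
rewrite /total_curvature subr_ge0; apply: (le_trans (bigmin_le_id _ _ _ _)).
rewrite ler_pdivrMr // mul1r.
by have /andP[] := marginal_curvature_bounds jV.
Qed.

Lemma modular_sum_bounds (X : {set 'I_n.+1}) :
  (1 - total_curvature f) * modular_sum f X <= f X <= modular_sum f X.
Proof.
rewrite mulr_sumr; apply: sum_marginal_bounds marginal_curvature_bounds.
exact: polymatroid0 f_poly.
Qed.

Lemma curve_normalizedK (k : R) (X : {set 'I_n.+1}) : total_curvature f <= k ->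
  curve_denormalized k f (curve_normalized k f) X = f X.
Proof.
move=> le_k; rewrite /curve_denormalized /curve_normalized.
case: ltrP => [k_gt0|k_le0]; first by field; rewrite gt_eqF.
(* In the default branch, [k] and the curvature are squeezed to 0, and the two bounds of
   [modular_sum_bounds] coincide. *)
have curv_ge0 := total_curvature_ge0.
have curv0 : total_curvature f = 0 by lra.
have -> : k = 0 by lra.
by have := modular_sum_bounds X; rewrite curv0; lra.
Qed.

(** Allowing every [k] from the curvature up to 1 covers both halves of the theorem at once, zero
    curvature included. *)
Lemma curve_denormalized_bounds (alpha k : R) (g : {set 'I_n.+1} -> R)
    (X : {set 'I_n.+1}) :
  1 <= alpha -> total_curvature f <= k -> k < 1 ->
  g X <= curve_normalized k f X -> curve_normalized k f X <= alpha * g X ->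
  let fhat := curve_denormalized k f g in
  [/\ fhat X <= f X,
      f X <= alpha / (1 + (alpha - 1) * (1 - k)) * fhat X
    & alpha / (1 + (alpha - 1) * (1 - k)) * fhat X <= fhat X / (1 - k)].
Proof.
move=> alpha_ge1 le_k k_lt1 le_gh le_hg fhat.
have k_ge0 : 0 <= k := le_trans total_curvature_ge0 le_k.
have fX_ge0 : 0 <= f X by case: f_poly.
have /andP[_ fX_le] := modular_sum_bounds X.
have fXE := curve_normalizedK X le_k; rewrite /curve_denormalized in fXE.
(* The nonlinear products are formed by hand, so that the goals left to [lra] are linear in the
   monomials. *)
have kg_le := ler_wpM2l k_ge0 le_gh.
have kh_le := ler_wpM2l k_ge0 le_hg.
have c_ge0 : 0 <= (alpha - 1) * (1 - k) by apply: mulr_ge0; lra.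
have cf_le := ler_wpM2l c_ge0 fX_le.
have D_gt0 : 0 < 1 + (alpha - 1) * (1 - k) by lra.
have mid : f X * (1 + (alpha - 1) * (1 - k)) <= alpha * fhat X.
  by rewrite /fhat /curve_denormalized; lra.
have fhat_ge0 : 0 <= fhat X.
  rewrite -(pmulr_rge0 _ (lt_le_trans ltr01 alpha_ge1)).
  by apply: le_trans mid; rewrite mulr_ge0 // ltW.
split; first by rewrite /fhat /curve_denormalized; lra.
  by rewrite mulrAC ler_pdivlMr.
rewrite [leRHS]mulrC; apply: ler_wpM2r => //.
(* After clearing denominators, the two sides differ by exactly [k]. *)
by rewrite ler_pdivrMr // mulrC ler_pdivlMr ?subr_gt0 //; lra.
Qed.

End Polymatroid.

Theorem theorem1 (R : realFieldType) (n : nat) (f : {set 'I_n.+1} -> R)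
    (f_poly : polymatroid f)
    (f_pos : forall j : 'I_n.+1, 0 < f [set j])
    (curv_lt1 : total_curvature f < 1)
    (alpha : R) (alpha_ge1 : 1 <= alpha) :
  (forall (fkhat : {set 'I_n.+1} -> R) (X : {set 'I_n.+1}),
     submodular fkhat ->
     fkhat X <= curve_normalized (total_curvature f) f X ->
     curve_normalized (total_curvature f) f X <= alpha * fkhat X ->
     let kappa := total_curvature f in
     let fhat := curve_denormalized kappa f fkhat in
     [/\ fhat X <= f X,
         f X <= alpha / (1 + (alpha - 1) * (1 - kappa)) * fhat X
       & alpha / (1 + (alpha - 1) * (1 - kappa)) * fhat X
           <= fhat X / (1 - kappa)])
  /\
  (forall (kbar : R) (ghat : {set 'I_n.+1} -> R) (X : {set 'I_n.+1}),
     total_curvature f <= kbar -> kbar < 1 -> 0 < kbar ->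
     submodular ghat ->
     ghat X <= curve_normalized kbar f X ->
     curve_normalized kbar f X <= alpha * ghat X ->
     let fhat := curve_denormalized kbar f ghat in
     [/\ fhat X <= f X,
         f X <= alpha / (1 + (alpha - 1) * (1 - kbar)) * fhat X
       & alpha / (1 + (alpha - 1) * (1 - kbar)) * fhat X
           <= fhat X / (1 - kbar)]).
Proof.
split=> [fkhat X _ le_gh le_hg|kbar ghat X le_k k_lt1 _ _ le_gh le_hg].
  exact: curve_denormalized_bounds.
exact: curve_denormalized_bounds.
Qed.
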